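(* For all $k\geq4$ and $n\geq3$, the DCell $D_{k,n}$ is super-$\lambda_3$: every minimum $3$-restricted edge-cut $F$ of $D_{k,n}$ is such that $D_{k,n}-F$ has a component that is a connected subgraph on exactly three vertices.
   Context: DCell $D_{k,n}$ ($n\geq 2$, $k\geq 0$) is defined recursively. $D_{0,n}$ is the complete graph $K_n$ on vertices $0,1,\dots,n-1$. Let $t_{k,n}=|V(D_{k,n})|$. For $k\geq1$, $D_{k,n}$ is built from $t_{k-1,n}+1$ disjoint copies $D^0_{k-1,n},\dots,D^{t_{k-1,n}}_{k-1,n}$ of $D_{k-1,n}$; a vertex of copy $D^i_{k-1,n}$ is labeled $(i,a_{k-1},\dots,a_0)$, where $(a_{k-1},\dots,a_0)$ is its label in $D_{k-1,n}$, and its index within the copy is $uid_{k-1}=a_0+\sum_{l=1}^{k-1}a_l t_{l-1,n}$. For each pair $a<b$ of copy indices, one edge joins the vertex of $D^a_{k-1,n}$ with $uid_{k-1}=b-1$ to the vertex of $D^b_{k-1,n}$ with $uid_{k-1}=a$. An edge set $F$ is an $m$-restricted edge-cut of $G$ if $G-F$ is disconnected and every component has at least $m$ vertices; $G$ is super-$\lambda_m$ if every minimum $m$-restricted edge-cut isolates a connected subgraph on exactly $m$ vertices. *)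

(* Defs.v *)
From mathcomp Require Import all_boot.

Set Implicit Arguments.
Unset Strict Implicit.
Unset Printing Implicit Defensive.

(* A simple graph on a finType is given by its adjacency relation, assumed
   symmetric and irreflexive; an edge is the two-element set of its ends. *)
Definition edges (T : finType) (e : rel T) : {set {set T}} :=
  [set [set p.1; p.2] | p : T * T & e p.1 p.2].

Definition edge_del (T : finType) (e : rel T) (F : {set {set T}}) : rel T :=
  [rel x y | e x y && ([set x; y] \notin F)].

(* Vertex sets of the connected components; [connect] is an equivalence only
   when the relation is symmetric. *)
Definition components (T : finType) (e : rel T) : {set {set T}} :=
  [set [set y | connect e x y] | x : T].

Definition connected (T : finType) (e : rel T) : bool :=
  [forall x, forall y, connect e x y].

Definition restricted_edge_cut (T : finType) (e : rel T) (m : nat)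
    (F : {set {set T}}) : bool :=
  [&& F \subset edges e,
      ~~ connected (edge_del e F)
    & [forall C in components (edge_del e F), m <= #|C|]].

Definition min_restricted_edge_cut (T : finType) (e : rel T) (m : nat)
    (F : {set {set T}}) : Prop :=
  restricted_edge_cut e m F /\
  forall F' : {set {set T}}, restricted_edge_cut e m F' -> #|F| <= #|F'|.

Definition super_lambda (T : finType) (e : rel T) (m : nat) : Prop :=
  forall F : {set {set T}}, min_restricted_edge_cut e m F ->
  exists2 C : {set T}, C \in components (edge_del e F) & #|C| = m.

(* The label (a_k, ..., a_0) is the nested pair (a_k, (..., (a_1, a_0))), with
   a_l <= t_{l-1,n} for l > 0 and a_0 < n. *)
Fixpoint dcell_vertex (n k : nat) : finType :=
  if k is k'.+1 then ('I_#|dcell_vertex n k'|.+1 * dcell_vertex n k')%type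
  else 'I_n.

Definition dcell_card (n k : nat) : nat := #|dcell_vertex n k|.

(* uid_k = a_0 + \sum_(1 <= l <= k) a_l * t_{l-1,n} *)
Fixpoint dcell_uid (n k : nat) : dcell_vertex n k -> nat :=
  match k return dcell_vertex n k -> nat with
  | 0 => fun a => a
  | k'.+1 => fun v => dcell_uid v.2 + v.1 * dcell_card n k'
  end.

(* When a < b below, b is positive, so the truncated b.-1 is b - 1. *)
Definition dcell_link (n k : nat) (u v : dcell_vertex n k.+1) : bool :=
  [&& u.1 < v.1, dcell_uid u.2 == v.1.-1 & dcell_uid v.2 == u.1].

Fixpoint dcell_adj (n k : nat) : rel (dcell_vertex n k) :=
  match k return rel (dcell_vertex n k) with
  | 0 => fun a b => a != b
  | k'.+1 => fun u v =>
      [|| (u.1 == v.1) && dcell_adj u.2 v.2, dcell_link u v | dcell_link v u]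
  end.

Lemma dcell_adj_sym (n k : nat) : symmetric (@dcell_adj n k).
Proof.
elim: k => [|k IHk] u v /=; first by rewrite eq_sym.
by rewrite eq_sym IHk; congr (_ || _); rewrite orbC.
Qed.

Lemma dcell_adj_irr (n k : nat) : irreflexive (@dcell_adj n k).
Proof.
elim: k => [|k IHk] u /=; first by rewrite eqxx.
by rewrite IHk andbF /dcell_link ltnn.
Qed.

(* Main.v *)
(* Let t be the number of vertices of D_(k-1) and X a vertex set of D_k. Every
   copy of D_(k-1) that X splits contributes at least the degree of D_(k-1) to
   the cut of X, and every pair of a full and an empty copy contributes its link.
   Three split copies already give more edges than the cut of a triangle, and so
   does the coexistence of full and empty copies, since then at least about t
   links are cut. So, up to complement, X lies in one or two copies. Inside one
   copy one descends, each vertex of X paying one further edge per level; in two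
   copies the bounds m (d + 1 - m) for sets of m vertices in a graph of degree d
   suffice. Hence a cut with at least four vertices on both sides is larger than
   the cut of a triangle, and the latter is a 3-restricted edge-cut. *)

Require Import Defs.
From mathcomp Require Import all_boot zify.

(** * Edge cuts and degrees *)

Definition cut {T : finType} (e : rel T) (X : {set T}) : nat :=
  \sum_(x in X) \sum_(y in ~: X) e x y.

Definition degree {T : finType} (e : rel T) (x : T) : nat := \sum_y e x y.

Definition slice {I T : finType} (X : {set I * T}) (i : I) : {set T} :=
  [set u | (i, u) \in X].

(** With [f] sending a vertex to its neighbour in another copy, these are the vertices of [X] whose
    link is cut. *)
Definition outgoing {T : finType} (f : T -> T) (X : {set T}) : {set T} :=
  [set x in X | f x \notin X].

Lemma cutC {T : finType} (e : rel T) (X : {set T}) :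
  symmetric e -> cut e (~: X) = cut e X.
Proof.
move=> e_sym; rewrite /cut setCK exchange_big.
by apply: eq_bigr => x _; apply: eq_bigr => y _; rewrite e_sym.
Qed.

(** A vertex of [X] has at most [#|X| - 1] neighbours inside [X], hence at least [d + 1 - #|X|]
    outside. Truncated subtraction makes the bound void when [#|X|] exceeds [d]. *)
Lemma cut_degree {T : finType} (e : rel T) (X : {set T}) (d : nat) :
  irreflexive e -> (forall x, d <= degree e x) ->
  #|X| * (d.+1 - #|X|) <= cut e X.
Proof.
move=> e_irr e_deg; rewrite /cut -sum_nat_const; apply: leq_sum => x Xx.
have := e_deg x; rewrite /degree (bigID (mem X)) /= (bigD1 x) //= e_irr.
have /[!sum1_card] cX : \sum_(y in X | y != x) e x y <= \sum_(y in X :\ x) 1.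
  rewrite [leqRHS](eq_bigl (fun y => (y \in X) && (y != x))); last first.
    by move=> y; rewrite !inE andbC.
  by apply: leq_sum => y _; apply: leq_b1.
have -> : \sum_(y in ~: X) e x y = \sum_(y | y \notin X) e x y.
  by apply: eq_bigl => y; rewrite inE.
move: cX (cardsD1 x X); rewrite Xx; lia.
Qed.

(** * Graphs made of copies, with one link per vertex *)

Lemma card_slices {I T : finType} (X : {set I * T}) :
  #|X| = \sum_i #|slice X i|.
Proof.
rewrite -sum1_card (eq_bigl (fun p => (p.1, p.2) \in X)); last by case.
rewrite -(pair_big_dep predT (fun i u => (i, u) \in X) (fun _ _ => 1)) /=.
by apply: eq_bigr => i _; rewrite -sum1_card; apply: eq_bigl => u; rewrite inE.
Qed.

(** Since [pt x] lies in another copy, the two alternatives of adjacency exclude each other and the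
    sum splits. [A] is everything for degrees and the complement of [X] for cuts. *)
Lemma sum_adj_step {I T : finType} (e : rel T) (f : rel (I * T))
    (pt : I * T -> I * T) (x : I * T) (A : pred (I * T)) :
  (forall x, (pt x).1 != x.1) ->
  (forall x y, f x y = (x.1 == y.1) && e x.2 y.2 || (y == pt x)) ->
  \sum_(y | A y) f x y = \sum_(u | A (x.1, u)) e x.2 u + A (pt x).
Proof.
move=> pt_neq fE.
under eq_bigr => y _.
  have -> : (f x y : nat) = ((x.1 == y.1) && e x.2 y.2) + (y == pt x).
    rewrite fE; case: (y =P pt x) => [->|_]; last by rewrite orbF addn0.
    by rewrite [x.1 == _]eq_sym (negPf (pt_neq x)).
  over.
rewrite big_split /=; congr (_ + _); last first.
  rewrite big_mkcond (bigD1 (pt x)) //= eqxx big1 => [|y /negPf->].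
    by rewrite addn0; case: (A _).
  by rewrite if_same.
rewrite (eq_bigl (fun y => A (y.1, y.2))); last by case.
rewrite -(pair_big_dep predT (fun i u => A (i, u))
  (fun i u => (x.1 == i) && e x.2 u : nat)) /=.
rewrite (bigD1 x.1) //= [X in _ + X]big1 => [|i /negPf]; last first.
  by move=> neq_i; rewrite big1 // => u _; rewrite eq_sym neq_i.
by rewrite addn0; apply: eq_bigr => u _; rewrite eqxx.
Qed.

Lemma degree_step {I T : finType} (e : rel T) (f : rel (I * T))
    (pt : I * T -> I * T) (x : I * T) :
  (forall x, (pt x).1 != x.1) ->
  (forall x y, f x y = (x.1 == y.1) && e x.2 y.2 || (y == pt x)) ->
  degree f x = (degree e x.2).+1.
Proof.
move=> pt_neq fE.
by rewrite /degree (sum_adj_step e f pt x predT pt_neq fE) addn1.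
Qed.

Lemma cut_step {I T : finType} (e : rel T) (f : rel (I * T))
    (pt : I * T -> I * T) (X : {set I * T}) :
  (forall x, (pt x).1 != x.1) ->
  (forall x y, f x y = (x.1 == y.1) && e x.2 y.2 || (y == pt x)) ->
  cut f X = \sum_i cut e (slice X i) + #|outgoing pt X|.
Proof.
move=> pt_neq fE; rewrite /cut.
under eq_bigr => x _ do rewrite (sum_adj_step e f pt x (mem (~: X)) pt_neq fE).
rewrite big_split /=; congr (_ + _); last first.
  rewrite -sum1_card big_mkcond [RHS]big_mkcond.
  by apply: eq_bigr => x _; rewrite !inE; do 2!case: (_ \in X).
rewrite (eq_bigl (fun p => (p.1, p.2) \in X)); last by case.
rewrite -(pair_big_dep predT (fun i u => (i, u) \in X)
  (fun i v => \sum_(u | (i, u) \in ~: X) e v u)) /=.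
apply: eq_bigr => i _; apply: eq_big => u; first by rewrite inE.
by move=> _; apply: eq_bigl => v; rewrite !inE.
Qed.

(** * Split, full and empty copies *)

Definition split_copies {I T : finType} (X : {set I * T}) : {set I} :=
  [set i | (slice X i != set0) && (slice X i != setT)].

Definition full_copies {I T : finType} (X : {set I * T}) : {set I} :=
  [set i | slice X i == setT].

Definition empty_copies {I T : finType} (X : {set I * T}) : {set I} :=
  [set i | slice X i == set0].

Lemma card_copies {I T : finType} (X : {set I * T}) :
  0 < #|T| ->
  #|split_copies X| + #|full_copies X| + #|empty_copies X| = #|I|.
Proof.
move=> T_gt0; have T_neq0 : (set0 == [set: T]) = false.
  by rewrite eq_sym; apply/negbTE; rewrite -card_gt0 cardsT.
rewrite -!sum1_card !(big_mkcond (fun i => i \in _)) -!big_split.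
apply: eq_bigr => i _; rewrite !inE; case: (_ =P set0) => [->|_].
  by rewrite T_neq0.
by case: eqP.
Qed.

Lemma sliceC {I T : finType} (X : {set I * T}) (i : I) :
  slice (~: X) i = ~: slice X i.
Proof. by apply/setP => u; rewrite !inE. Qed.

Lemma full_copiesC {I T : finType} (X : {set I * T}) :
  full_copies (~: X) = empty_copies X.
Proof.
by apply/setP => i; rewrite !inE sliceC -(inj_eq (@setC_inj _)) setCK setCT.
Qed.

Lemma full_copies_card {I T : finType} (X : {set I * T}) :
  #|full_copies X| * #|T| <= #|X|.
Proof.
rewrite card_slices (bigID (mem (full_copies X))) /= -sum_nat_const.
apply: leq_trans (leq_addr _ _); apply: leq_sum => i.
by rewrite inE => /eqP->; rewrite cardsT.
Qed.

(** A full copy is linked to every empty one, and the end of that link in the full copy is outgoing.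
    So sending an outgoing vertex to its copy and its partner's copy covers all full-empty pairs. *)
Lemma outgoing_full_empty {I T : finType} (pt : I * T -> I * T)
    (X : {set I * T}) :
  (forall i j, i != j -> exists u, (pt (i, u)).1 = j) ->
  0 < #|T| ->
  #|full_copies X| * #|empty_copies X| <= #|outgoing pt X|.
Proof.
move=> pt_onto T_gt0; rewrite -cardsX.
apply: leq_trans (leq_imset_card (fun x => (x.1, (pt x).1)) _).
apply: subset_leq_card; apply/subsetP => -[i j]; rewrite !inE /= => /andP[/eqP Xi /eqP Xj].
have [u0 _] : exists u : T, u \in [set: T] by apply/card_gt0P; rewrite cardsT.
have ij : i != j.
  by apply: contraTneq isT => ij; move: (in_setT u0); rewrite -Xi ij Xj inE.
have [u pt_u] := pt_onto _ _ ij.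
apply/imsetP; exists (i, u); rewrite ?pt_u // inE.
move: (in_setT u) (in_set0 (pt (i, u)).2); rewrite -Xi -Xj !inE => -> /=.
by rewrite -pt_u -surjective_pairing => ->.
Qed.

Lemma sum_cut_split {I T : finType} (e : rel T) (X : {set I * T}) (d : nat) :
  (forall Y : {set T}, Y != set0 -> Y != setT -> d <= cut e Y) ->
  #|split_copies X| * d <= \sum_i cut e (slice X i).
Proof.
move=> e_conn; rewrite (bigID (mem (split_copies X))) /= -sum_nat_const.
apply: leq_trans (leq_addr _ _); apply: leq_sum => i.
by rewrite inE => /andP[]; apply: e_conn.
Qed.

Lemma slice_outside {I T : finType} (X : {set I * T}) (i : I) :
  full_copies X = set0 -> i \notin split_copies X -> slice X i = set0.
Proof.
move/setP/(_ i); rewrite !inE => ->; rewrite andbT negbK.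
exact: eqP.
Qed.

Lemma mem_split_copies {I T : finType} (X : {set I * T}) (x : I * T) :
  full_copies X = set0 -> x \in X -> x.1 \in split_copies X.
Proof.
move=> X_full Xx; apply: contraT => /(slice_outside X _ X_full)/setP/(_ x.2).
by rewrite !inE -surjective_pairing Xx.
Qed.

(** Partners lie in other copies, which here miss [X], so every vertex of [X] is outgoing and pays
    one further edge. *)
Lemma single_copy {I T : finType} (e : rel T) (pt : I * T -> I * T)
    (X : {set I * T}) :
  (forall x, (pt x).1 != x.1) -> full_copies X = set0 ->
  #|split_copies X| = 1 ->
  exists i, [/\ #|slice X i| = #|X|, slice X i != set0, slice X i != setT
    & \sum_i cut e (slice X i) + #|outgoing pt X|
      = cut e (slice X i) + #|slice X i|].
Proof.
move=> pt_neq X_full /eqP/cards1P[i Xi]; exists i.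
have cut0 : cut e set0 = 0 by rewrite /cut big_set0.
have out j : j != i -> slice X j = set0.
  by move=> ji; apply: slice_outside; rewrite ?Xi ?inE.
have := set11 i; rewrite -Xi inE => /andP[-> ->].
have cX : #|slice X i| = #|X|.
  by rewrite [RHS]card_slices (bigD1 i) //= big1 ?addn0 // => j /out->; rewrite cards0.
split=> //; rewrite (bigD1 i) //= big1 => [|j /out-> //].
rewrite addn0 cX; congr (_ + #|pred_of_set _|).
apply/setP => x; rewrite inE andb_idr // => Xx.
apply: contra (pt_neq x) => /(mem_split_copies X _ X_full).
by move: (mem_split_copies X _ X_full Xx); rewrite Xi !inE => /eqP-> /eqP->.
Qed.

(** Each of the two copies sends at most one vertex to the other, so at most two vertices of [X]
    keep their partner in [X]; all others are outgoing. *)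
Lemma two_copies {I T : finType} (e : rel T) (pt : I * T -> I * T)
    (X : {set I * T}) :
  (forall x, (pt x).1 != x.1) ->
  (forall i, injective (fun u => (pt (i, u)).1)) ->
  full_copies X = set0 -> #|split_copies X| = 2 ->
  exists Y Z : {set T},
  [/\ Y != set0, Y != setT, Z != set0, Z != setT & #|Y| + #|Z| = #|X|] /\
    cut e Y + cut e Z + #|X|
      <= \sum_i cut e (slice X i) + #|outgoing pt X| + 2.
Proof.
move=> pt_neq pt_inj X_full /eqP/cards2P[i [j [ij Xij]]].
exists (slice X i), (slice X j).
have cut0 : cut e set0 = 0 by rewrite /cut big_set0.
have out l : (l != i) && (l != j) -> slice X l = set0.
  by move=> lij; apply: slice_outside; rewrite ?Xij ?inE ?negb_or.
have := set21 i j; rewrite -Xij inE => /andP[-> ->].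
have := set22 i j; rewrite -Xij inE => /andP[-> ->].
split; first split=> //.
  rewrite [RHS]card_slices (bigD1 i) //= (bigD1 j) 1?eq_sym //= big1 ?addn0 //.
  by move=> l /out->; rewrite cards0.
rewrite (bigD1 i) //= (bigD1 j) 1?eq_sym //= big1 ?addn0 => [|l /out-> //].
rewrite -!addnA !leq_add2l.
pose B := [set x in X | pt x \in X].
have -> : #|X| = #|outgoing pt X| + #|B|.
  rewrite addnC -(cardsID [set x | pt x \in X] X).
  by congr (_ + _); apply: eq_card => x; rewrite !inE // andbC.
rewrite leq_add2l -[leqRHS](_ : #|[set i; j]| = _); last by rewrite cards2 ij.
rewrite -(card_in_imset (f := fun x => x.1) (D := B)).
  apply/subset_leq_card/subsetP => _ /imsetP[x + ->].
  by rewrite inE -Xij => /andP[Xx _]; apply: mem_split_copies.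
(* A partner that stays in [X] lies in the other of the two copies. Hence vertices of [B] in the
   same copy have partners in the same copy and coincide by [pt_inj]. *)
have dest x : x \in B -> (pt x).1 = if x.1 == i then j else i.
  rewrite inE => /andP[/(mem_split_copies X _ X_full) + /(mem_split_copies X _ X_full)].
  rewrite Xij !inE => /orP[] /eqP xE /orP[] /eqP pE; move: (pt_neq x).
  - by rewrite pE xE eqxx.
  - by rewrite pE xE eqxx.
  - by rewrite pE xE eq_sym => /negPf->.
  by rewrite pE xE eqxx.
move=> [a u] [b v] Bx By /= ab; move: Bx By; rewrite -{b}ab => /dest + /dest /=.
by move=> <- /(pt_inj a) ->.
Qed.

(** * Orders, uids and partners in DCell *)

Lemma dcell_card_step (n k : nat) :
  dcell_card n k.+1 = (dcell_card n k).+1 * dcell_card n k.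
Proof. by rewrite {1}/dcell_card card_prod card_ord. Qed.

Lemma dcell_card_gt0 (n k : nat) : 0 < n -> 0 < dcell_card n k.
Proof.
move=> n_gt0; elim: k => [|k IHk]; first by rewrite /dcell_card card_ord.
by rewrite dcell_card_step muln_gt0.
Qed.

Lemma dcell_uid_lt (n k : nat) (u : dcell_vertex n k) :
  dcell_uid u < dcell_card n k.
Proof.
elim: k u => [|k IHk] u; first by rewrite /dcell_card card_ord /=.
rewrite dcell_card_step mulSn /=; apply: leq_add (IHk _) _.
by rewrite leq_mul2r -ltnS ltn_ord orbT.
Qed.

Lemma dcell_uid_inj (n k : nat) : injective (@dcell_uid n k).
Proof.
elim: k => [|k IHk] u v /=; first exact: val_inj.
have t_gt0 : 0 < dcell_card n k by apply: leq_ltn_trans (dcell_uid_lt n k u.2).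
move=> uv; have uid_eq : dcell_uid u.2 = dcell_uid v.2.
  have /= := congr1 (fun m => m %% dcell_card n k) uv.
  by rewrite ![_ + _ * _]addnC !modnMDl !modn_small ?dcell_uid_lt.
move: uv; rewrite uid_eq => /addnI/eqP; rewrite eqn_pmul2r // => /eqP/val_inj.
by move/IHk: uid_eq; case: u v => [? ?] [? ?] /= -> ->.
Qed.

Definition dcell_rank (n k : nat) (u : dcell_vertex n k) :
  'I_#|dcell_vertex n k| := Ordinal (dcell_uid_lt n k u).

Lemma dcell_rank_inj (n k : nat) : injective (dcell_rank n k).
Proof. by move=> u v [/dcell_uid_inj]. Qed.

Lemma dcell_rank_codom (n k : nat) (i : 'I_#|dcell_vertex n k|) :
  i \in codom (dcell_rank n k).
Proof. by apply: inj_card_onto (dcell_rank_inj n k) _ i; rewrite card_ord. Qed.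

(* The vertex with uid c in copy a is joined to copy b = bump a c, where its
   neighbour has the uid c' such that bump b c' = a. *)
Definition dcell_partner (n k : nat) (x : dcell_vertex n k.+1) :
    dcell_vertex n k.+1 :=
  let b := lift x.1 (dcell_rank n k x.2) in
  (b, iinv (dcell_rank_codom n k (odflt (dcell_rank n k x.2) (unlift b x.1)))).

Lemma dcell_partner_neq (n k : nat) (x : dcell_vertex n k.+1) :
  (dcell_partner n k x).1 != x.1.
Proof. by rewrite eq_sym neq_lift. Qed.

Lemma dcell_partner_inj (n k : nat) (i : 'I_#|dcell_vertex n k|.+1) :
  injective (fun u => (dcell_partner n k (i, u)).1).
Proof. by move=> u v /lift_inj/dcell_rank_inj. Qed.

Lemma dcell_partner_onto (n k : nat) (i j : 'I_#|dcell_vertex n k|.+1) :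
  i != j -> exists u, (dcell_partner n k (i, u)).1 = j.
Proof.
case/unlift_some => c -> _; exists (iinv (dcell_rank_codom n k c)).
by rewrite /= f_iinv.
Qed.

(** The default of [odflt] is never reached: the partner's copy [b] differs from [x.1], so [unlift]
    succeeds. *)
Lemma dcell_partner_uid (n k : nat) (x : dcell_vertex n k.+1) :
  bump (dcell_partner n k x).1 (dcell_uid (dcell_partner n k x).2) = x.1.
Proof.
have := dcell_partner_neq n k x; rewrite /dcell_partner /=.
set b := lift _ _; move=> /unlift_some[c xE ->] /=.
have := f_iinv (dcell_rank_codom n k c) => /(congr1 val) /= ->.
by rewrite {2}xE.
Qed.

(** For a < b, [bump a (b - 1)] is b and [bump b a] is a, so one function describes both
    orientations of the link. *)
Lemma dcell_adj_step (n k : nat) (x y : dcell_vertex n k.+1) :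
  dcell_adj x y
  = (x.1 == y.1) && dcell_adj x.2 y.2 || (y == dcell_partner n k x).
Proof.
rewrite /=; congr (_ || _).
have pt_uid := dcell_partner_uid n k x.
have pt_fst : (dcell_partner n k x).1 = bump x.1 (dcell_uid x.2) :> nat by [].
move: (dcell_partner n k x) pt_uid pt_fst => z pt_uid pt_fst.
apply/idP/eqP => [xy|->]; last first.
  move: pt_uid pt_fst; rewrite /dcell_link /bump; lia.
have fstE : y.1 = z.1.
  by apply: ord_inj; move: xy pt_fst; rewrite /dcell_link /bump; lia.
have sndE : y.2 = z.2.
  by apply: dcell_uid_inj; move: xy pt_uid; rewrite -fstE /dcell_link /bump; lia.
by rewrite [y]surjective_pairing fstE sndE -surjective_pairing.
Qed.

Lemma dcell_degree (n k : nat) (x : dcell_vertex n k) :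
  0 < n -> degree (@dcell_adj n k) x = n + k - 1.
Proof.
move=> n_gt0; elim: k x => [|k IHk] x.
  rewrite /degree (bigD1 x) //= eqxx.
  rewrite (eq_bigr (fun=> 1)) => [|y]; last by rewrite eq_sym => ->.
  by have := cardC1 x; rewrite -sum1_card card_ord addn0 subn1 => <-.
rewrite (degree_step _ _ _ x (dcell_partner_neq n k) (dcell_adj_step n k)) IHk.
lia.
Qed.

Lemma dcell_card_ge (n k : nat) : 2 < n -> n * 4 ^ k <= dcell_card n k.
Proof.
move=> n_gt2; elim: k => [|k IHk]; first by rewrite /dcell_card card_ord muln1.
have : 0 < 4 ^ k by rewrite expn_gt0.
rewrite dcell_card_step expnS; nia.
Qed.

(** * Edge connectivity of DCell *)

Lemma cut_complete (n : nat) (X : {set 'I_n}) :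
  cut (@dcell_adj n 0) X = #|X| * (n - #|X|).
Proof.
rewrite /cut -sum_nat_const; apply: eq_bigr => x Xx.
have <- : #|~: X| = n - #|X| by rewrite cardsCs setCK card_ord.
rewrite -sum1_card; apply: eq_bigr => y; rewrite inE /=.
by case: (x =P y) => // <-; rewrite Xx.
Qed.

Lemma dcell_cut_step (n k : nat) (X : {set dcell_vertex n k.+1}) :
  cut (@dcell_adj n k.+1) X
  = \sum_i cut (@dcell_adj n k) (slice X i) + #|outgoing (dcell_partner n k) X|.
Proof. exact: cut_step (dcell_partner_neq n k) (dcell_adj_step n k). Qed.

Lemma dcell_cut_split (n k d : nat) (X : {set dcell_vertex n k.+1}) :
  0 < n ->
  (forall Y : {set dcell_vertex n k}, Y != set0 -> Y != setT ->
     d <= cut (@dcell_adj n k) Y) ->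
  #|split_copies X| * d + #|full_copies X| * #|empty_copies X|
    <= cut (@dcell_adj n k.+1) X.
Proof.
move=> n_gt0 cut_ge; rewrite dcell_cut_step leq_add //.
  exact: sum_cut_split.
apply: outgoing_full_empty; first exact: dcell_partner_onto.
exact: dcell_card_gt0.
Qed.

Lemma dcell_copies (n k : nat) (X : {set dcell_vertex n k.+1}) :
  0 < n ->
  #|split_copies X| + #|full_copies X| + #|empty_copies X| = (dcell_card n k).+1.
Proof. by move=> n_gt0; rewrite card_copies ?dcell_card_gt0 ?card_ord. Qed.

(** Positive p and q satisfy p q >= p + q - 1, and s d >= s, so the right side is at least s + p + q
    - 1 = t. *)
Lemma full_empty_bound (s p q t d : nat) :
  s + p + q = t.+1 -> 0 < p -> 0 < q -> 0 < d -> t <= s * d + p * q.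
Proof. by case: p q d => [|p] [|q] [|d] //; nia. Qed.

(** The bound is the degree. In the induction step, two split copies give twice the previous degree,
    a full and an empty copy together give at least t edges, and a single split copy gives the
    previous degree plus one link per vertex. *)
Lemma dcell_edge_connectivity (n k : nat) (X : {set dcell_vertex n k}) :
  2 < n -> X != set0 -> X != setT -> n + k - 1 <= cut (@dcell_adj n k) X.
Proof.
move=> n_gt2; elim: k X => [|k IHk] X X_neq0 X_neqT.
  have : #|X| < n by rewrite -[ltnRHS]card_ord -cardsT proper_card // properT.
  move: X_neq0; rewrite cut_complete -card_gt0.
  move: #|X| => m m_gt0 m_lt; have [[|c] nE] : exists c, n = m + c.
  - by exists (n - m); lia.
  - by lia.
  by rewrite {2}nE addKn; case: m m_gt0 {m_lt} nE => [//|m] _ ->; nia.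
have n_gt0 : 0 < n by lia.
(* Complementation swaps full and empty copies, so full copies may be assumed absent unless empty
   ones exist too. *)
wlog X_full : X X_neq0 X_neqT / #|full_copies X| = 0 \/
    0 < #|full_copies X| /\ 0 < #|empty_copies X|.
  move=> wlogX; have [/eqP|full_gt0] := posnP #|full_copies X|.
    by move=> /eqP X_full; apply: wlogX => //; left.
  have [empty0|empty_gt0] := posnP #|empty_copies X|; last first.
    by apply: wlogX => //; right.
  rewrite -cutC; last exact: dcell_adj_sym.
  apply: wlogX; rewrite ?full_copiesC; last by left.
    by apply: contraNneq X_neqT => XC; rewrite -[X]setCK XC setC0.
  by apply: contraNneq X_neq0 => XC; rewrite -[X]setCK XC setCT.
have := dcell_cut_split n k _ X n_gt0 IHk.
have := dcell_copies n k X n_gt0.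
have := dcell_card_ge n k n_gt2.
have : k < 4 ^ k by apply: ltn_expl.
case: X_full => [/eqP|[p_gt0 q_gt0] pow_k t_ge sum_t]; last first.
  have d_gt0 : 0 < n + k - 1 by lia.
  by have := full_empty_bound _ _ _ _ _ sum_t p_gt0 q_gt0 d_gt0; nia.
rewrite cards_eq0 => /eqP X_full.
move=> _ _ _ cut_ge; have [s_ge2|s_le1] := leqP 2 #|split_copies X|.
  have : 2 * (n + k - 1) <= #|split_copies X| * (n + k - 1) by rewrite leq_mul.
  lia.
have [s0|s_gt0] := posnP #|split_copies X|.
  case/set0Pn: X_neq0 => x /(mem_split_copies X x X_full).
  by rewrite (cards0_eq s0) inE.
have s1 : #|split_copies X| = 1 by lia.
have [i [_ i_neq0 i_neqT]] :=
  single_copy (@dcell_adj n k) _ X (dcell_partner_neq n k) X_full s1.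
rewrite dcell_cut_step => ->; have := IHk _ i_neq0 i_neqT.
move: i_neq0; rewrite -card_gt0; lia.
Qed.

(** * Lower bound for cuts with at least four vertices on each side *)

Lemma two_copies_bound (a b d x y : nat) :
  0 < a -> 0 < b -> 3 < a + b -> d <= x -> d <= y ->
  a * (d.+1 - a) <= x -> b * (d.+1 - b) <= y -> 3 * d < x + y + (a + b) + 1.
Proof.
move=> a_gt0 b_gt0 ab_gt3 x_ge y_ge ax by_.
(* If a + b >= d, the bounds x >= d and y >= d suffice. *)
have [|ab_lt] := leqP d (a + b); first by lia.
wlog ab : a b x y a_gt0 b_gt0 ab_gt3 x_ge y_ge ax by_ ab_lt / a <= b.
  move=> wlogab; have [|/ltnW ba] := leqP a b; first exact: wlogab.
  by rewrite (addnC x) (addnC a); apply: wlogab => //; rewrite addnC.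
(* With d = a + b + e + 1 the two sides differ by at least 2ab - 2 + (a + b - 3)e, which is
   positive. *)
have [e dE] : exists e, d = a + b + e.+1 by exists (d - (a + b)).-1; lia.
move: by_ ax; rewrite dE.
have -> : (a + b + e.+1).+1 - b = a + e + 2 by lia.
have -> : (a + b + e.+1).+1 - a = b + e + 2 by lia.
case: a a_gt0 ab_gt3 ab {ab_lt dE} => [|[|a]] //; nia.
Qed.

Lemma pow4_ge (k : nat) : 3 * k < 4 ^ k.
Proof. by elim: k => // k IHk; rewrite expnS; lia. Qed.

(** Here [c] is the cut, [m] the size of [X] and [t] the order of a copy; a full copy gives t <= m.
    Exponential growth of [t] decides, except for k = 0, where r >= 3 is forced. *)
Lemma mixed_copies_bound (n k r t m c : nat) :
  2 < n -> 3 < k.+1 + r -> n * 4 ^ k <= t -> t <= m -> 3 < m -> t <= c ->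
  3 * (n + k.+1 + r) < c + r * m + 9.
Proof.
move=> n_gt2 kr t_ge tm m_gt3 tc; have pow_k := pow4_ge k.
case: k kr pow_k t_ge => [|k] kr pow_k t_ge.
  rewrite muln1 in t_ge; have [n_le3|n_gt3] := leqP n 3.
    have : r * 4 <= r * m by rewrite leq_mul2l m_gt3 orbT.
    lia.
  have : r * n <= r * m by rewrite leq_mul2l (leq_trans t_ge tm) orbT.
  (* As (r - 2)(n - 3) > 0, [r * n] exceeds 2n + 3r - 6; adding c >= n gives the claim. *)
  have : r * n = (r - 2) * (n - 3) + 2 * n + 3 * r - 6 by nia.
  have : 0 < (r - 2) * (n - 3) by rewrite muln_gt0; lia.
  lia.
have : n * (3 * k.+1).+1 <= n * 4 ^ k.+1 by rewrite leq_mul2l pow_k orbT.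
have : r * 3 <= r * m by rewrite leq_mul2l; lia.
nia.
Qed.

(** Without empty copies [X] is so large that, for r > 0, its weight [r * m] alone suffices. *)
Lemma full_copies_bound (n k r t p m : nat) :
  2 < n -> 3 < k.+1 + r -> 0 < r -> n * 4 ^ k <= t -> t <= p.+1 ->
  p * t <= m -> 3 * (n + k.+1 + r) < r * m + 9.
Proof.
move=> n_gt2 kr r_gt0 t_ge tp ptm; have pow_k := pow4_ge k.
(* Since t >= 3, there are p >= t - 1 >= 2 full copies. *)
have m_ge : r * (2 * t) <= r * m.
  by rewrite leq_mul2l (leq_trans _ ptm) ?orbT // leq_mul2r; nia.
have tn : n * (3 * k).+1 <= t by apply: leq_trans t_ge; rewrite leq_mul2l pow_k orbT.
have : r * (n * (3 * k).+1) <= r * t by rewrite leq_mul2l tn orbT.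
case: k kr {tn pow_k t_ge} => [|k] kr; first by rewrite muln0 muln1; nia.
nia.
Qed.

(* If D_k is a copy inside D_(k + r), then [cut X + r * #|X|] is the size of the
   cut of X in D_(k + r), and 3 (n + k + r - 3) is that of a triangle. *)
Lemma dcell_cut_gt (n k r : nat) (X : {set dcell_vertex n k}) :
  2 < n -> 3 < k + r -> 3 < #|X| -> 0 < r \/ 3 < #|~: X| ->
  3 * (n + k + r) < cut (@dcell_adj n k) X + r * #|X| + 9.
Proof.
move=> n_gt2; elim: k r X => [|k IHk] r X kr X_gt3 rX.
  have : #|X| <= n by rewrite -[leqRHS]card_ord max_card.
  (* With m = #|X| and c = n - m the sides differ by (m - 3)(c + r - 3), positive because k = 0
     forces r > 3. *)
  rewrite cut_complete; move: #|X| X_gt3 => m m_gt3 /subnKC nE.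
  move: (n - m) nE kr {rX} => c <-; nia.
have n_gt0 : 0 < n by lia.
(* The weight [r * #|X|] is not symmetric, so passing to the complement is possible only for r = 0;
   this leaves the third alternative. *)
wlog copiesX : X X_gt3 rX / [\/ #|full_copies X| = 0,
    0 < #|full_copies X| /\ 0 < #|empty_copies X| |
    #|empty_copies X| = 0 /\ 0 < r].
  move=> wlogX; have [full0|full_gt0] := posnP #|full_copies X|.
    by apply: wlogX => //; constructor 1.
  have [empty0|empty_gt0] := posnP #|empty_copies X|; last first.
    by apply: wlogX => //; constructor 2.
  have [r0|r_gt0] := posnP r; last by apply: wlogX => //; constructor 3.
  have XC_gt3 : 3 < #|~: X| by case: rX; rewrite ?r0.
  have := wlogX (~: X) XC_gt3; rewrite setCK full_copiesC r0 !mul0n.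
  rewrite cutC; last exact: dcell_adj_sym.
  by apply; [right | constructor 1].
have d_cut := dcell_edge_connectivity n k _ n_gt2.
have cut_ge := dcell_cut_split n k _ X n_gt0 d_cut.
have sum_t := dcell_copies n k X n_gt0.
have t_ge := dcell_card_ge n k n_gt2.
have r_ge : r * 4 <= r * #|X| by rewrite leq_mul2l X_gt3 orbT.
have [s_ge3|s_le2] := leqP 3 #|split_copies X|.
  have : 3 * (n + k - 1) <= #|split_copies X| * (n + k - 1) by rewrite leq_mul.
  lia.
case: copiesX => [/eqP|[p_gt0 q_gt0]|[q0 r_gt0]]; last first.
(* At most two copies are split and none is empty, so at least t - 1 are full. *)
- have t_le : dcell_card n k <= #|full_copies X|.+1 by lia.
  have := full_copies_bound n k r _ _ _ n_gt2 kr r_gt0 t_ge t_le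
    (full_copies_card X).
  by move/leq_trans; apply; rewrite leq_add2r leq_addl.
- have d_gt0 : 0 < n + k - 1 by lia.
  have := full_empty_bound _ _ _ _ _ sum_t p_gt0 q_gt0 d_gt0.
  move/leq_trans/(_ cut_ge); apply: mixed_copies_bound => //.
  by apply: leq_trans (full_copies_card X); rewrite leq_pmull.
rewrite cards_eq0 => /eqP X_full.
have [s0|s_gt0] := posnP #|split_copies X|.
  have /card_gt0P[x /(mem_split_copies X x X_full)] : 0 < #|X| by lia.
  by rewrite (cards0_eq s0) inE.
have [s1|s_neq1] := eqVneq #|split_copies X| 1.
  rewrite dcell_cut_step; have [i [cX _ _ ->]] := single_copy (@dcell_adj n k) _ X
    (dcell_partner_neq n k) X_full s1.
  (* The [#|X|] outgoing links raise the weight from [r] to [r.+1], and the induction descends into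
     the copy. *)
  have kr1 : 3 < k + r.+1 by lia.
  have := IHk r.+1 (slice X i) kr1; rewrite cX (mulSn r) addnA.
  have -> : n + k + r.+1 = n + k.+1 + r by lia.
  by apply=> //; left.
have s2 : #|split_copies X| = 2 by lia.
have [Y [Z [[Y0 YT Z0 ZT cX] cutX]]] := two_copies (@dcell_adj n k) _ X
  (dcell_partner_neq n k) (dcell_partner_inj n k) X_full s2.
have deg_ge x : n + k - 1 <= degree (@dcell_adj n k) x by rewrite dcell_degree.
have cut_deg V := cut_degree _ V _ (@dcell_adj_irr n k) deg_ge.
(* The 2 stands for the vertices whose partner stays in [X], the 1 comes from [two_copies_bound]. *)
have cut_gt : 3 * (n + k - 1) < cut (@dcell_adj n k.+1) X + 2 + 1.
  have YZ_gt3 : 3 < #|Y| + #|Z| by rewrite cX.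
  have := two_copies_bound _ _ _ _ _ _ _ YZ_gt3
    (d_cut _ Y0 YT) (d_cut _ Z0 ZT) (cut_deg Y) (cut_deg Z).
  rewrite !card_gt0 Y0 Z0 cX => /(_ isT isT)/leq_trans; apply.
  by rewrite dcell_cut_step leq_add2r.
lia.
Qed.

(** * Boundaries as restricted edge-cuts *)

Definition boundary {T : finType} (e : rel T) (X : {set T}) : {set {set T}} :=
  [set [set p.1; p.2] | p : T * T & [&& p.1 \in X, p.2 \notin X & e p.1 p.2]].

(** Exactly one end of a boundary edge lies in [X], so the edge determines the ordered pair. *)
Lemma card_boundary {T : finType} (e : rel T) (X : {set T}) :
  #|boundary e X| = cut e X.
Proof.
rewrite card_in_imset => [|[x y] [u v]]; last first.
  rewrite !inE /= => /and3P[Xx XNy _] /and3P[Xu XNv _] /setP xy_uv.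
  have xu : x = u.
    by have := xy_uv x; rewrite !inE eqxx => /esym/orP[] /eqP // xv;
       rewrite -xv Xx in XNv.
  have yv : y = v.
    by have := xy_uv y; rewrite !inE eqxx orbT => /esym/orP[] /eqP // yu;
       rewrite yu Xu in XNy.
  by rewrite xu yv.
rewrite /cut pair_big_dep /= -sum1_card big_mkcond [RHS]big_mkcond.
by apply: eq_bigr => p _; rewrite !inE /=; do 2!case: (_ \in X) => //=; case: (e _ _).
Qed.

Lemma boundary_edges {T : finType} (e : rel T) (X : {set T}) :
  boundary e X \subset edges e.
Proof.
apply/subsetP => _ /imsetP[p + ->]; rewrite inE => /and3P[_ _ e_p].
by apply/imsetP; exists p; rewrite ?inE.
Qed.

Lemma boundary_crosses {T : finType} (e : rel T) (X : {set T}) (x y : T) :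
  [set x; y] \in boundary e X -> (x \in X) = (y \notin X).
Proof.
case/imsetP => -[u v]; rewrite inE /= => /and3P[Xu XNv _] xy_uv.
have : u \in [set x; y] by rewrite xy_uv set21.
have : v \in [set x; y] by rewrite xy_uv set22.
case/set2P => vE /set2P[] uE; move: Xu XNv; rewrite uE vE;
  by case: (x \in X); case: (y \in X).
Qed.

Lemma edge_del_sym {T : finType} (e : rel T) (F : {set {set T}}) :
  symmetric e -> symmetric (edge_del e F).
Proof. by move=> e_sym x y; rewrite /edge_del /= e_sym setUC. Qed.

(** An edge leaving the component but not in [F] would survive and extend the component. *)
Lemma component_boundary {T : finType} (e : rel T) (F : {set {set T}}) (x : T) :
  boundary e [set y | connect (edge_del e F) x y] \subset F.
Proof.
apply/subsetP => _ /imsetP[[u v] + ->]; rewrite !inE /= => /and3P[xu xNv e_uv].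
apply: contraNT xNv => uvNF; apply: connect_trans xu _.
by apply: connect1; rewrite /edge_del /= e_uv.
Qed.

Lemma degree_card {T : finType} (e : rel T) (x : T) :
  degree e x = #|[set y | e x y]|.
Proof.
rewrite /degree -sum1_card [RHS]big_mkcond.
by apply: eq_bigr => y _; rewrite inE; case: (e x y).
Qed.

Definition clique {T : finType} (e : rel T) (X : {set T}) : Prop :=
  forall x y, x \in X -> y \in X -> x != y -> e x y.

Lemma cut_clique {T : finType} (e : rel T) (X : {set T}) (d : nat) :
  (forall x, degree e x = d) -> clique e X ->
  cut e X <= #|X| * (d.+1 - #|X|).
Proof.
move=> e_deg X_clique; rewrite /cut -sum_nat_const; apply: leq_sum => x Xx.
have := e_deg x; rewrite /degree (bigID (mem X)) /= (bigD1 x) //=.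
have -> : \sum_(y in X | y != x) e x y = #|X :\ x|.
  rewrite -sum1_card; apply: eq_big => y; first by rewrite !inE andbC.
  by case/andP => Xy; rewrite eq_sym => /(X_clique _ _ Xx Xy) ->.
have -> : \sum_(y in ~: X) e x y = \sum_(y | y \notin X) e x y.
  by apply: eq_bigl => y; rewrite inE.
rewrite (cardsD1 x X) Xx; lia.
Qed.

(** A vertex of [X] stays connected to the whole clique. A vertex outside has at most [#|X|] of its
    [d] neighbours in [X] and keeps the others, at least [#|X|] in number. *)
Lemma clique_restricted_edge_cut {T : finType} (e : rel T) (X : {set T})
    (d : nat) :
  symmetric e -> (forall x, degree e x = d) -> clique e X -> 0 < #|X| -> #|X| + #|X| <= d ->
  restricted_edge_cut e #|X| (boundary e X).
Proof.
move=> e_sym e_deg X_clique X_gt0 X_le; apply/and3P; split.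
- exact: boundary_edges.
- have [x Xx] := card_gt0P X_gt0.
  have [y XNy] : exists y, y \notin X.
    apply/existsP; apply: contraT; rewrite negb_exists => /forallP XT.
    have := max_card [set y | e x y]; rewrite -degree_card e_deg.
    have -> : #|T| = #|X|.
      by rewrite -cardsT; congr #|pred_of_set _|; apply/setP => y;
         rewrite inE; have := XT y; rewrite negbK.
    lia.
  have X_closed : closed (edge_del e (boundary e X)) (mem X).
    move=> u v /andP[e_uv]; apply: contraNeq => uXv.
    have [Xu|XNu] := boolP (u \in X).
      apply/imsetP; exists (u, v); rewrite // inE /= Xu e_uv andbT.
      by move: uXv; rewrite Xu; case: (v \in X).
    rewrite setUC; apply/imsetP; exists (v, u); rewrite // inE /= XNu e_sym e_uv.
    by move: uXv; rewrite (negPf XNu); case: (v \in X).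
  apply/negP => /forallP/(_ x)/forallP/(_ y)/(closed_connect X_closed).
  by rewrite Xx (negPf XNy).
apply/forallP => C; apply/implyP => /imsetP[x _ ->].
have [Xx|XNx] := boolP (x \in X).
  apply/subset_leq_card/subsetP => y Xy; rewrite inE.
  have [<-|xy] := eqVneq x y; first exact: connect0.
  apply: connect1; rewrite /edge_del /= X_clique //=.
  by apply/negP => /boundary_crosses; rewrite Xx Xy.
apply: (@leq_trans #|[set y | e x y] :\: X|).
  have := cardsID X [set y | e x y]; rewrite -degree_card e_deg.
  have := subset_leq_card (subsetIr [set y | e x y] X); lia.
apply/subset_leq_card/subsetP => y; rewrite !inE => /andP[XNy e_xy].
apply: connect1; rewrite /edge_del /= e_xy.
by apply/negP => /boundary_crosses; rewrite XNy (negPf XNx).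
Qed.

(** * Triangles and the conclusion *)

Lemma dcell_triangle (n k : nat) :
  2 < n -> exists2 X : {set dcell_vertex n k}, #|X| = 3 & clique (@dcell_adj n k) X.
Proof.
move=> n_gt2; elim: k => [|k [X cX X_clique]].
  exists [set widen_ord n_gt2 i | i : 'I_3]; last by move=> x y _ _ xy; exact: xy.
  rewrite card_imset ?card_ord // => i j /(congr1 val) /= ij; exact: val_inj.
exists [set (ord0, u) | u in X]; first by rewrite card_imset // => u v [].
move=> _ _ /imsetP[u Xu ->] /imsetP[v Xv ->] uv.
by rewrite dcell_adj_step /= X_clique //; apply: contraNneq uv => ->.
Qed.

Theorem theorem11 (k n : nat) (hk : 4 <= k) (hn : 3 <= n) :
  super_lambda (@dcell_adj n k) 3.
Proof.
move=> F [F_cut F_min].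
have [T cT T_clique] := dcell_triangle n k hn.
have deg x : degree (@dcell_adj n k) x = n + k - 1 by apply: dcell_degree; lia.
have F_le : #|F| <= 3 * (n + k - 3).
  have T_cut := clique_restricted_edge_cut _ T _ (@dcell_adj_sym n k) deg T_clique.
  (* The bounds on [k] and [n] make the degree n + k - 1 at least 6, twice the size of a
     triangle. *)
  rewrite cT in T_cut; apply: leq_trans (F_min _ (T_cut _ _)) _ => //; first by lia.
  rewrite card_boundary; apply: leq_trans (cut_clique _ T _ deg T_clique) _.
  by rewrite cT; lia.
case/and3P: F_cut => _ F_disc /forallP F_comp.
pose e := edge_del (@dcell_adj n k) F.
have e_sym : connect_sym e.
  exact/sym_connect_sym/edge_del_sym/dcell_adj_sym.
pose C x := [set y | connect e x y].
have C_comp x : C x \in components e by apply: imset_f.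
have C_ge3 x : 2 < #|C x| by have /implyP := F_comp (C x); apply.
have [x /forallPn[y xy]] := forallPn F_disc.
have [Cx3|Cx_neq3] := eqVneq #|C x| 3; first by exists (C x).
have [Cy3|Cy_neq3] := eqVneq #|C y| 3; first by exists (C y).
have Cx_gt3 : 3 < #|C x| by rewrite ltn_neqAle eq_sym Cx_neq3 C_ge3.
have CxC_gt3 : 3 < #|~: C x|.
  apply: (@leq_trans #|C y|); first by rewrite ltn_neqAle eq_sym Cy_neq3 C_ge3.
  apply/subset_leq_card/subsetP => z; rewrite !inE => yz.
  by apply: contra xy => xz; apply: connect_trans xz _; rewrite e_sym.
(* Taken with r = 0, the bound makes the boundary of [C x] larger than the cut of a triangle; but it
   is contained in [F], contradicting [F_le]. *)
have := dcell_cut_gt n k 0 (C x) hn; rewrite addn0 => /(_ hk Cx_gt3 (or_intror CxC_gt3)).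
have := subset_leq_card (component_boundary (@dcell_adj n k) F x).
rewrite card_boundary -/(C x) mul0n addn0; lia.
Qed.
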